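(* Let $A \in \mathbb{C}_{n,m}$ and $D, E \in \mathbb{C}_{m,n}$ be such that $A^{\parallel (D,E)}$ exists. Let $r=\mathrm{rk}(D)=\mathrm{rk}(E)=\mathrm{rk}(EAD)$. Let $P\in \mathbb{C}_{m,m}$ and $Q \in \mathbb{C}_{n,n}$ be two nonsingular matrices such that $$PEADQ=\begin{bmatrix} I_r & 0 \\ 0 & 0\end{bmatrix}.$$ Then $$PE=\begin{bmatrix} X \\ 0 \end{bmatrix} \qquad \text{and} \qquad DQ=\begin{bmatrix} Y & 0 \end{bmatrix},$$ where $X \in \mathbb{C}_{r,n}$ and $Y \in \mathbb{C}_{m,r}$. Furthermore, $A^{\parallel (D,E)}=YX$.
   Context: $\mathbb{C}_{m,n}$ is the set of $m\times n$ complex matrices ($m,n\in\mathbb{N}$); $I_r$ is the identity matrix of order $r$. For a matrix $M\in\mathbb{C}_{p,q}$, $\mathcal{R}(M)$ is its column space, $\mathcal{N}(M)=\{\mathbf{x}\in\mathbb{C}^q: M\mathbf{x}=\mathbf{0}\}$ its null space, and $\mathrm{rk}(M)$ its rank. For $A \in \mathbb{C}_{n,m}$ and $D,E \in \mathbb{C}_{m,n}$, $A$ is $(D,E)$-invertible if there exists $X\in\mathbb{C}_{m,n}$ such that $XAD=D$, $EAX=E$, $\mathcal{R}(X)\subseteq\mathcal{R}(D)$ and $\mathcal{N}(E)\subseteq\mathcal{N}(X)$. Such an $X$ is unique if it exists; it is called the $(D,E)$-inverse of $A$ and denoted $A^{\parallel (D,E)}$. When $A^{\parallel (D,E)}$ exists,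 one has $\mathrm{rk}(D)=\mathrm{rk}(E)=\mathrm{rk}(EAD)$, so $r$ is well defined. *)

(* Defs.v *)
From mathcomp Require Import all_boot all_order all_algebra.
From mathcomp Require Import classical_sets reals complex.

Set Implicit Arguments.
Unset Strict Implicit.
Unset Printing Implicit Defensive.

Import GRing.Theory.
Local Open Scope ring_scope.
Local Open Scope classical_set_scope.

Section Defs.
Variable F : fieldType.

(* Column and null spaces as sets of column vectors: mathcomp's [%MS]
   subspace order and [kermx] are about row vectors instead. *)
Definition colspace p q (M : 'M[F]_(p, q)) : set 'cV[F]_p :=
  range (fun x : 'cV[F]_q => M *m x).

Definition nullspace p q (M : 'M[F]_(p, q)) : set 'cV[F]_q :=
  [set x | M *m x = 0].

Variables n m : nat.
Implicit Types (A : 'M[F]_(n, m)) (D E X : 'M[F]_(m, n)).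

Definition is_DE_inverse A D E X : Prop :=
  [/\ X *m A *m D = D,
      E *m A *m X = E,
      colspace X `<=` colspace D &
      nullspace E `<=` nullspace X].

Definition DE_invertible A D E : Prop := exists X, is_DE_inverse A D E X.

(* Equal to 0, by convention, when A is not (D, E)-invertible. *)
Definition DE_inverse A D E : 'M[F]_(m, n) :=
  xget 0 [set X | is_DE_inverse A D E X].

Lemma mulmx_cV_inj p q (M N : 'M[F]_(p, q)) :
  (forall x : 'cV[F]_q, M *m x = N *m x) -> M = N.
Proof.
move=> MN; apply/matrixP => i j.
have /matrixP/(_ i 0) := MN (delta_mx j 0).
by rewrite -!colE !mxE.
Qed.

Lemma is_DE_inverse_uniq A D E X X' :
  is_DE_inverse A D E X -> is_DE_inverse A D E X' -> X = X'.
Proof.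
move=> [_ EAX sXD _] [XAD _ _ sEX]; apply: mulmx_cV_inj => y.
have [z _ Dz] : colspace D (X *m y) by apply: sXD; exists y.
have : nullspace X' (A *m X *m y - y).
  by apply: sEX; rewrite /nullspace /= mulmxBr !mulmxA EAX subrr.
rewrite /nullspace /= mulmxBr => /subr0_eq <-.
by rewrite -!mulmxA -Dz !mulmxA XAD.
Qed.

Lemma DE_inverseP A D E :
  DE_invertible A D E -> is_DE_inverse A D E (DE_inverse A D E).
Proof. by case=> X hX; apply: (xgetPex 0); exists X. Qed.

Lemma DE_inverse_eq A D E X : is_DE_inverse A D E X -> DE_inverse A D E = X.
Proof.
by move=> hX; apply: is_DE_inverse_uniq (hX); apply: DE_inverseP; exists X.
Qed.

Lemma DE_invertible_rank A D E : DE_invertible A D E ->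
  \rank D = \rank (E *m A *m D) /\ \rank E = \rank (E *m A *m D).
Proof.
case=> X [XAD EAX sXD sEX].
have /submxP[W XE] : (X <= E)%MS.
  rewrite submxE; apply/eqP/mulmx_cV_inj => x; rewrite mul0mx -mulmxA.
  by apply: sEX; rewrite /nullspace /= mulmxA mulmx_coker mul0mx.
have /submxP[Z XD] : (X^T <= D^T)%MS.
  apply/row_subP => j; rewrite -tr_col colE.
  have [z _ <-] : colspace D (X *m delta_mx j 0) by apply: sXD; exists (delta_mx j 0).
  by rewrite trmx_mul submxMl.
have {}XD : X = D *m Z^T by rewrite -[LHS]trmxK XD trmx_mul trmxK.
split; apply/eqP; rewrite eqn_leq; apply/andP; split.
- by rewrite -{1}XAD XE -!mulmxA mxrankM_maxr.
- exact: mxrankM_maxr.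
- by rewrite -{1}EAX XD mulmxA mxrankM_maxl.
- by rewrite -mulmxA mxrankM_maxl.
Qed.

End Defs.

(* Main.v *)
Require Import Defs.
From mathcomp Require Import all_boot all_order all_algebra.
From mathcomp Require Import classical_sets reals complex.

Set Implicit Arguments.
Unset Strict Implicit.
Unset Printing Implicit Defensive.

Import GRing.Theory.
Local Open Scope ring_scope.

(** Multiplying [E] by [A *m D] does not lower its rank, so [E] and
    [E *m A *m D] have the same column space; dually, [D] and [E *m A *m D]
    have the same row space.  Put [G := P *m E] and [H := D *m Q], so that
    [J := G *m A *m H] is the partial identity of rank [r].  The same rank
    comparison makes the columns of [G] combinations of those of [J]
    ([mulmx_rankl_factor]), so [G] vanishes below row [r]; likewise [H]
    vanishes beyond column [r] ([mulmx_rankr_factor]).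

    With [X] the top of [G] and [Y] the left part of [H], the product
    [Y *m X] is [H *m J^T *m G].  Since [J *m J^T] fixes [G] and [J^T *m J]
    fixes [H], this product [Z] satisfies [Z *m A *m H = H] and
    [G *m A *m Z = G]; cancelling [P] and [Q] gives the two equations of the
    (D,E)-inverse.  The inclusions of spaces hold because [Z] has [D] as a
    left factor and [E] as a right factor ([is_DE_inverse_mul]), and the
    (D,E)-inverse is unique.

    Blocks are handled through rectangular partial identities: padding with
    zeros and truncating to [r] rows or columns are both multiplications by
    some [pid_mx r], which confines the dimension casts to
    [castmx_col_mx0] and [castmx_row_mx0]. *)

Section FullRankFactor.
Variable F : fieldType.

(** The row space of [M *m N] lies in that of [N], so equal dimensions force
    the two spaces to coincide. *)
Lemma mulmx_rankr_factor p q s (M : 'M[F]_(p, q)) (N : 'M[F]_(q, s)) :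
  \rank (M *m N) = \rank N -> exists Z, N = Z *m (M *m N).
Proof.
move=> rkN; apply/submxP.
by rewrite -(geq_leqif (mxrank_leqif_sup (submxMl M N))) rkN.
Qed.

Lemma mulmx_rankl_factor p q s (M : 'M[F]_(p, q)) (N : 'M[F]_(q, s)) :
  \rank (M *m N) = \rank M -> exists Z, M = M *m N *m Z.
Proof.
rewrite -mxrank_tr -(mxrank_tr M) trmx_mul => /mulmx_rankr_factor[Z MZ].
by exists Z^T; apply: trmx_inj; rewrite !trmx_mul trmxK.
Qed.

End FullRankFactor.

Section PartialIdentity.
Variable F : fieldType.

Lemma castmx_col_mx0 p a r s (e : (r + a)%N = p) (X : 'M[F]_(r, s)) :
  castmx (e, erefl s) (col_mx X 0) = pid_mx r *m X.
Proof.
case: p / e; rewrite castmx_id pid_mx_col mul_col_mx mul0mx.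
by rewrite mul1mx.
Qed.

Lemma castmx_row_mx0 p a r s (e : (r + a)%N = p) (Y : 'M[F]_(s, r)) :
  castmx (erefl s, e) (row_mx Y 0) = Y *m pid_mx r.
Proof.
case: p / e; rewrite castmx_id pid_mx_row mul_mx_row mulmx0.
by rewrite mulmx1.
Qed.

End PartialIdentity.

(** A left factor [D] forces the inclusion of column spaces and a right factor
    [E] that of null spaces, so only the two equations have to be checked. *)
Lemma is_DE_inverse_mul (F : fieldType) n m (A : 'M[F]_(n, m))
    (D E : 'M[F]_(m, n)) (W : 'M[F]_(n, m)) :
  D *m W *m E *m A *m D = D -> E *m A *m (D *m W *m E) = E ->
  is_DE_inverse A D E (D *m W *m E).
Proof.
move=> XAD EAX; split=> // x.
  by case=> y _ <-; exists (W *m E *m y); rewrite ?mulmxA.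
by rewrite /nullspace /= -mulmxA => ->; rewrite mulmx0.
Qed.

Theorem theorem9p2 (R : realType) (m n r : nat)
  (A : 'M[R[i]%C]_(n, m)) (D E : 'M[R[i]%C]_(m, n))
  (hinv : DE_invertible A D E)
  (hrD : r = \rank D) (hrE : r = \rank E) (hrEAD : r = \rank (E *m A *m D))
  (P : 'M[R[i]%C]_m) (Q : 'M[R[i]%C]_n)
  (hP : P \in unitmx) (hQ : Q \in unitmx)
  (hPQ : P *m E *m A *m D *m Q = pid_mx r) :
  exists (X : 'M[R[i]%C]_(r, n)) (Y : 'M[R[i]%C]_(m, r))
         (em : (r + (m - r))%N = m) (en : (r + (n - r))%N = n),
    [/\ P *m E = castmx (em, erefl n) (col_mx X 0),
        D *m Q = castmx (erefl m, en) (row_mx Y 0) &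
        DE_inverse A D E = Y *m X].
Proof.
have ler_m : (r <= m)%N by rewrite hrD rank_leq_row.
have ler_n : (r <= n)%N by rewrite hrD rank_leq_col.
have EADQ : P *m E *m (A *m (D *m Q)) = pid_mx r by rewrite !mulmxA.
have PEAD : P *m E *m A *m (D *m Q) = pid_mx r by rewrite mulmxA.
have rk_pid : \rank (pid_mx r : 'M[R[i]%C]_(m, n)) = r.
  by rewrite rank_pid_mx.
(* Being fixed by [pid_mx r] is how vanishing below row [r], or beyond column
   [r], is expressed without blocks. *)
have topPE : pid_mx r *m (P *m E) = P *m E.
  have [|Z ->] := @mulmx_rankl_factor _ _ _ _ (P *m E) (A *m (D *m Q)).
    by rewrite EADQ rk_pid hrE (eqmxMfull _ _) ?row_full_unit.
  by rewrite EADQ mulmxA pid_mx_id.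
have leftDQ : D *m Q *m pid_mx r = D *m Q.
  have [|Z ->] := @mulmx_rankr_factor _ _ _ _ (P *m E *m A) (D *m Q).
    by rewrite PEAD rk_pid hrD mxrankMfree ?row_free_unit.
  by rewrite PEAD -mulmxA pid_mx_id.
exists (pid_mx r *m (P *m E)), (D *m Q *m pid_mx r).
exists (subnKC ler_m), (subnKC ler_n); split.
- by rewrite castmx_col_mx0 [RHS]mulmxA pid_mx_id ?topPE.
- by rewrite castmx_row_mx0 -[RHS]mulmxA pid_mx_id ?leftDQ.
apply: DE_inverse_eq.
have -> : D *m Q *m pid_mx r *m ((pid_mx r : 'M_(r, m)) *m (P *m E))
    = D *m (Q *m pid_mx r *m P) *m E.
  (* The n x m partial identity factors through dimension [r], one half going
     to each of the two blocks. *)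
  by rewrite -(@pid_mx_id _ n r m r (leqnn r)) !mulmxA.
apply: is_DE_inverse_mul.
- apply: (can_inj (mulmxK hQ)).
  transitivity (D *m Q *m (pid_mx r *m (P *m E *m A *m (D *m Q)))).
    by rewrite !mulmxA.
  by rewrite PEAD pid_mx_id.
- apply: (can_inj (mulKmx hP)).
  transitivity (P *m E *m (A *m (D *m Q)) *m pid_mx r *m (P *m E)).
    by rewrite !mulmxA.
  by rewrite EADQ pid_mx_id.
Qed.
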